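(* Let $\mathcal S$ be a separable metric space, with metric written $\|s-s'\|$, equipped with a reference measure (integration written $ds$), and let $t_{\mathfrak s}:\mathcal S\times\mathcal S\to\mathbb R^{\ge0}$ be a transition density such that $|t_{\mathfrak s}(\bar s|s)-t_{\mathfrak s}(\bar s'|s)|\le\lambda_{\mathfrak f}\|\bar s-\bar s'\|$ for all $s,\bar s,\bar s'\in\mathcal S$, and such that $M_{\mathfrak f}:=\sup_{\bar s\in\mathcal S}\int_{\mathcal S}t_{\mathfrak s}(\bar s|s)\,ds$ is finite. Let $\Upsilon\subset\mathcal S$ be bounded, partitioned as $\Upsilon=\bigcup_{i=1}^n\mathcal A_i$ into pairwise disjoint measurable sets, choose representative points $s_i\in\mathcal A_i$, let $\delta_i=\sup\{\|s-s'\|:s,s'\in\mathcal A_i\}$ and $\delta=\max_i\delta_i$. Define the projection $\Pi_\Upsilon(f)=\sum_{i=1}^nf(s_i)\mathds 1_{\mathcal A_i}$ for $f\in\mathbb B(\Upsilon)$. Then $$\|\Pi_\Upsilon(t_{\mathfrak s}(\cdot|s))-t_{\mathfrak s}(\cdot|s)\|_\infty\le\lambda_{\mathfrak f}\delta\quad\text{for all } s\in\Upsilon.$$ Moreover, let $\pi_0$ be a probability density, $\Lambda_0\subset\Upsilon$, $\mu_0=\mathds 1_{\Lambda_0}\pi_0$, and $\mu_{t+1}(\bar s)=\int_\Upsilon t_{\mathfrak s}(\bar s|s)\mu_t(s)\,ds$ for $\bar s\in\Upsilon$. Let $P$ be the $n\times n$ matrix with $P(i,j)=\int_{\mathcal A_i}t_{\mathfrak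 s}(s_j|s)\,ds$, let the row vector $\boldsymbol\alpha_1$ have entries $\alpha_1(i)=\int_\Upsilon t_{\mathfrak s}(s_i|s)\mu_0(s)\,ds$, $\boldsymbol\alpha_{t+1}=\boldsymbol\alpha_tP$, and $\psi^{\mathfrak h}_t=\sum_{i=1}^n\alpha_t(i)\mathds 1_{\mathcal A_i}$. Then for all $t\in\{1,\dots,N\}$, $$\|\mu_t-\psi^{\mathfrak h}_t\|_\infty\le\lambda_{\mathfrak f}\delta\,\kappa(t,M_{\mathfrak f}),$$ where $\kappa(t,M)=\frac{1-M^t}{1-M}$ if $M\neq1$ and $\kappa(t,1)=t$.
   Context: $\mathbb B(\Upsilon)$ is the space of bounded measurable real functions on $\Upsilon$ with $\|f\|_\infty=\sup_{s\in\Upsilon}|f(s)|$; $\mathds 1_A$ is the indicator of $A$; $N\in\mathbb N$ is a fixed horizon. The functions $\psi^{\mathfrak h}_t$ coincide with $(\Pi_\Upsilon\mathcal R_\Upsilon)^t(\mu_0)$, where $\mathcal R_\Upsilon(f)(\bar s)=\int_\Upsilon t_{\mathfrak s}(\bar s|s)f(s)\,ds$. *)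

(* Defs.v *)
From HB Require Import structures.
From mathcomp Require Import all_boot all_order all_algebra.
From mathcomp Require Import all_classical all_reals all_analysis.

Set Implicit Arguments.
Unset Strict Implicit.
Unset Printing Implicit Defensive.

Import Order.TTheory GRing.Theory Num.Theory.
Import numFieldNormedType.Exports.

Local Open Scope classical_set_scope.
Local Open Scope ring_scope.

(* Metric spaces carrying their Borel sigma-algebra. *)
HB.mixin Record isBorel (d : measure_display) (R : numDomainType) S
    & Metric R S & Measurable d S := {
  measurable_borelE : (@measurable d S : set (set S)) = <<s @open S >>
}.

#[short(type="borelMetricType")]
HB.structure Definition BorelMetric (d : measure_display) (R : numDomainType) :=
  { S of Metric R S & Measurable d S & isBorel d R S }.

Definition separable (T : topologicalType) : Prop :=
  exists2 D : set T, countable D & dense D.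

Definition supnorm (R : realType) (T : Type) (D : set T) (f : T -> R) : \bar R :=
  ereal_sup [set (`|f s|)%:E | s in D].

Definition mbounded (R : realType) (S : metricType R) (D : set S) : Prop :=
  exists r : R, forall s s', D s -> D s' -> mdist s s' <= r.

(* Only meaningful on bounded sets: [sup] is 0 on unbounded ones. *)
Definition diam (R : realType) (S : metricType R) (D : set S) : R :=
  sup [set mdist s s' | s in D & s' in D].

Definition mesh (R : realType) (S : metricType R) (n : nat)
    (A : 'I_n -> set S) : R :=
  \big[Num.max/0]_(i < n) diam (A i).

Record probability_density d (S : measurableType d) (R : realType)
    (nu : {measure set S -> \bar R}) (p : S -> R) : Prop := {
  pdensity_measurable : measurable_fun setT p ;
  pdensity_ge0 : forall s, 0 <= p s ;
  pdensity_int : (\int[nu]_s (p s)%:E = 1)%E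
}.

(* [t sbar s] is the density at [sbar] of the law of the successor of [s]. *)
Record transition_density d (S : measurableType d) (R : realType)
    (nu : {measure set S -> \bar R}) (t : S -> S -> R) : Prop := {
  tdensity_measurable : measurable_fun setT (fun p : S * S => t p.1 p.2) ;
  tdensity_ge0 : forall sbar s, 0 <= t sbar s ;
  tdensity_int : forall s, (\int[nu]_sbar (t sbar s)%:E = 1)%E
}.

Definition is_partition d (S : measurableType d) (U : set S) (n : nat)
    (A : 'I_n -> set S) : Prop :=
  [/\ forall i, measurable (A i), trivIset setT A & U = \bigcup_i A i].

Section operators.
Context d (S : measurableType d) (R : realType).
Variables (nu : {measure set S -> \bar R}) (t : S -> S -> R) (U : set S).
Variables (n : nat) (A : 'I_n -> set S) (r : 'I_n -> S).

Definition Mf : \bar R :=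
  ereal_sup [set (\int[nu]_s (t sbar s)%:E)%E | sbar in setT].

Definition step_proj (f : S -> R) : S -> R :=
  fun s => \sum_(i < n) f (r i) * \1_(A i) s.

(* The functions on [U] are handled as functions on [S] whose values outside
   [U] play no role. *)
Definition Rop (f : S -> R) : S -> R :=
  fun sbar => \int[nu]_(s in U) (t sbar s * f s).

Definition mu_ (mu0 : S -> R) (k : nat) : S -> R := iter k Rop mu0.

Definition Pmx : 'M[R]_n := \matrix_(i, j) \int[nu]_(s in A i) t (r j) s.

Definition alpha1 (mu0 : S -> R) : 'rV[R]_n :=
  \row_i \int[nu]_(s in U) (t (r i) s * mu0 s).

(* Indexed from 1; the value at 0 is irrelevant. *)
Definition alpha (mu0 : S -> R) (k : nat) : 'rV[R]_n :=
  iter k.-1 (fun a => a *m Pmx) (alpha1 mu0).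

Definition psi (mu0 : S -> R) (k : nat) : S -> R :=
  fun s => \sum_(i < n) alpha mu0 k ord0 i * \1_(A i) s.

End operators.

Definition kappa (R : realType) (k : nat) (M : R) : R :=
  if M == 1 then k%:R else (1 - M ^+ k) / (1 - M).

(* Main.v *)
(* Since [psi_(k+1)] is the projection of [Rop psi_k], on the cell of [r i] the
   error [mu_(k+1) - psi_(k+1)] splits into the oscillation of [Rop mu_k] over
   the cell, at most [lambda * mesh A] times the mass of [mu_k], and
   [Rop (mu_k - psi_k) (r i)], at most [M] times the previous error; hence the
   geometric sum [kappa].
   That [mu_k] has mass at most 1 is Tonelli's theorem, but [nu] need not be
   sigma-finite.  By separability and the Lipschitz condition, the
   supports of countably many sections [t ^~ s] cover those of all the others;
   as these sections and [pi0] are integrable, every [mu_k] vanishes outside a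
   sigma-finite set [W]. *)

Require Import Defs.
From HB Require Import structures.
From mathcomp Require Import all_boot all_order all_algebra.
From mathcomp Require Import all_classical all_reals all_analysis.
From mathcomp Require Import measurable_realfun ring lra.

Set Implicit Arguments.
Unset Strict Implicit.
Unset Printing Implicit Defensive.

Import Order.TTheory GRing.Theory Num.Theory.
Import numFieldNormedType.Exports.

Local Open Scope classical_set_scope.
Local Open Scope ring_scope.

(** * Sigma-finite supports and Tonelli's theorem *)

(** By Markov's inequality each level set where [h i] is at least 1/(m+1) has finite measure, and
    these countably many sets exhaust the union of the supports. *)
Lemma sigma_finite_support d (S : measurableType d) (R : realType)
    (nu : {measure set S -> \bar R}) (h : nat -> S -> R) :
  (forall i, measurable_fun setT (h i)) -> (forall i x, 0 <= h i x) ->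
  (forall i, (\int[nu]_x (h i x)%:E < +oo)%E) ->
  sigma_finite [set x | exists i, 0 < h i x] nu.
Proof.
move=> mh h0 hoo.
(* [k] codes a pair (i, m); a number coding none falls back to (0, 0), which only repeats a set. *)
pose F (k : nat) := let c := odflt (0%N, 0%N) (unpickle k) in
  [set x | c.2.+1%:R^-1 <= h c.1 x].
exists F.
  apply/seteqP; split => [x /= [i hi]|x [k _ /= hk]]; last first.
    by eexists; exact: lt_le_trans hk.
  have [m hm] := ltr_add_invr hi; rewrite add0r in hm.
  by exists (pickle (i, m)) => //; rewrite /F pickleK/= ltW.
move=> k; rewrite /F; case: (odflt _ _) => i m /=.
have mE := (measurable_EFinP setT (h i)).2 (mh i).
have FE : [set x | m.+1%:R^-1 <= h i x] =
    setT `&` [set x | (m.+1%:R^-1%:E <= `|(h i x)%:E|)%E].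
  by rewrite setTI; apply/funext => x /=; rewrite lee_fin ger0_norm.
have im0 : 0 < m.+1%:R^-1 :> R by rewrite invr_gt0.
split.
  by rewrite FE; apply: emeasurable_fun_c_infty => //; exact: measurableT_comp.
have := le_integral_abse nu measurableT mE im0; rewrite -FE => hle.
rewrite -(@lte_pmul2l _ m.+1%:R^-1%:E) ?lte_fin// gt0_muley ?lte_fin//.
apply: (le_lt_trans hle); rewrite (_ : integral _ _ _ = \int[nu]_x (h i x)%:E)%E //.
by apply: eq_integral => x _ /=; rewrite ger0_norm.
Qed.

(** For each dense point a and each m, pick one s with [t a s] above 1/(m+1), if any exists. When
    [t x s'] is positive, some dense a near x has such an s, and the Lipschitz condition carries
    positivity back to x. *)
Lemma countable_kernel_supports (R : realType) (S : metricType R) (x0 : S)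
    (t : S -> S -> R) (lambda : R) :
  separable S ->
  (forall s x y, `|t x s - t y s| <= lambda * mdist x y) ->
  exists s : nat -> S, forall x s', 0 < t x s' -> exists i, 0 < t x (s i).
Proof.
move=> [D /countable_injP[f finj] dD] lip.
pose P (k m : nat) := [set s | exists a, [/\ D a, f a = k & m.+1%:R^-1 < t a s]].
pose s (k : nat) := let c := odflt (0%N, 0%N) (unpickle k) in
  xget x0 (P c.1 c.2).
exists s => x s' xs'.
(* Half of [t x s']: one margin [e] is spent in passing from x to a, another in passing back. *)
have [m hm] := ltr_add_invr (divr_gt0 xs' (ltr0Sn R 1)); rewrite add0r in hm.
set e := m.+1%:R^-1 in hm.
have e0 : 0 < e by rewrite invr_gt0.
have l0 : 0 < `|lambda| + 1 by rewrite ltr_wpDl.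
have [||a [/interior_subset xa Da]] := dD (ball x (e / (`|lambda| + 1)))°.
- by exists x; apply: nbhsx_ballx; rewrite divr_gt0.
- exact: open_interior.
move: xa; rewrite ballEmdist/= ltr_pdivlMr// => xa.
have {}xa : lambda * mdist x a < e.
  apply: le_lt_trans xa; rewrite mulrC ler_wpM2l ?mdist_ge0//.
  by rewrite (le_trans (ler_norm _))// lerDl.
have Pas : P (f a) m s'.
  exists a; split => //; rewrite -/e.
  by have := lip s' x a; rewrite ler_norml => /andP[_ ?]; lra.
exists (pickle (f a, m)); rewrite /s pickleK/=.
(* The chosen s is witnessed by some dense b numbered like a; injectivity of [f] on [D] forces b =
   a. *)
have [b [Db /finj fba tb]] := xgetI x0 Pas.
rewrite fba ?inE// -/e in tb.
by have := lip (xget x0 (P (f a) m)) x a; rewrite ler_norml => /andP[? _]; lra.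
Qed.

(** Restricted to [W] the measure is sigma-finite, and as [g] vanishes when either variable leaves
    [W], the restriction changes no integral. *)
Lemma fubini_tonelli_sigma_finite_support d (S : measurableType d)
    (R : realType) (nu : {measure set S -> \bar R}) (W : set S)
    (g : S * S -> \bar R) :
  sigma_finite W nu -> measurable_fun setT g -> (forall p, (0 <= g p)%E) ->
  (forall x y, ~ W x -> g (x, y) = 0%E) ->
  (forall x y, ~ W y -> g (x, y) = 0%E) ->
  measurable_fun setT (fun x => (\int[nu]_y g (x, y))%E) /\
  (\int[nu]_x \int[nu]_y g (x, y) = \int[nu]_y \int[nu]_x g (x, y))%E.
Proof.
move=> [F WF mF] mg g0 gl gr.
have mW : measurable W.
  by rewrite WF; apply: bigcup_measurable => i _; exact: (mF i).1.
pose nuW : {measure set S -> \bar R} := mrestr nu mW.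
have nuWoo : sigma_finite setT nuW.
  (* The complement of [W] is null for [nuW], so adjoining it covers the space and keeps the
     measures finite. *)
  exists (fun i => F i `|` ~` W).
    apply/esym; rewrite -subTset => x _; have [xW|xW] := pselect (W x).
      by move: xW; rewrite {1}WF => -[i _ Fx]; exists i => //; left.
    by exists 0%N => //; right.
  move=> i; split.
    by apply: measurableU; [exact: (mF i).1|exact: measurableC].
  rewrite /nuW /= /mrestr setIUl setICl setU0.
  apply: le_lt_trans (mF i).2; apply: le_measure; rewrite ?inE//.
    by apply: measurableI => //; exact: (mF i).1.
  exact: (mF i).1.
pose H := Measure_isSigmaFinite.Build _ _ _ _ nuWoo.
pose nuW' : {sigma_finite_measure set S -> \bar R} :=
  HB.pack_for {sigma_finite_measure set S -> \bar R} (Measure.sort nuW) H.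
have intW (f : S -> \bar R) : (forall x, ~ W x -> f x = 0%E) ->
    (\int[nu]_x f x = \int[nuW']_x f x)%E.
  move=> fW.
  have fWE : f = f \_ W.
    apply/funext => x; rewrite patchE; case: ifPn => // /negP xW.
    by rewrite fW// => /mem_set.
  rewrite fWE -!integral_mkcond.
  apply: eq_measure_integral => B mB BW.
  by rewrite /= /mrestr setIidl.
have intyW x : (\int[nu]_y g (x, y) = \int[nuW']_y g (x, y))%E.
  by apply: intW => y; exact: gr.
have intxW y : (\int[nu]_x g (x, y) = \int[nuW']_x g (x, y))%E.
  by apply: intW => x; exact: gl.
split.
  under eq_fun do rewrite intyW.
  exact: measurable_fun_fubini_tonelli_F.
rewrite intW; last first.
  by move=> x xW; rewrite integral0_eq// => y _; exact: gl.
rewrite [RHS]intW; last first.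
  by move=> y yW; rewrite integral0_eq// => x _; exact: gr.
under eq_integral do rewrite intyW.
under [RHS]eq_integral do rewrite intxW.
exact: fubini_tonelli.
Qed.

(** * The kernel operator on densities *)

Lemma measurable_kernel_section d (S : measurableType d) (R : realType)
    (nu : {measure set S -> \bar R}) (t : S -> S -> R) :
  transition_density nu t ->
  (forall x, measurable_fun setT (t x)) /\
  (forall s, measurable_fun setT (t ^~ s)).
Proof.
move=> [mt _ _]; split=> z.
  exact: (measurableT_comp mt (measurable_pair1 z)).
exact: (measurableT_comp mt (measurable_pair2 z)).
Qed.

(** Tonelli's theorem lets the successor variable be integrated first, and the density [t ^~ s] has
    mass one. *)
Lemma kernel_mass_preserving d (S : measurableType d) (R : realType)
    (nu : {measure set S -> \bar R}) (t : S -> S -> R) (U W : set S)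
    (f : S -> R) :
  transition_density nu t -> measurable U -> sigma_finite W nu ->
  (forall x s, ~ W x -> t x s = 0) ->
  measurable_fun setT f -> (forall s, 0 <= f s) ->
  (forall s, ~ W s -> f s = 0) ->
  measurable_fun setT (fun x => \int[nu]_(s in U) (t x s * f s)%:E)%E /\
  (\int[nu]_x \int[nu]_(s in U) (t x s * f s)%:E
    = \int[nu]_(s in U) (f s)%:E)%E.
Proof.
move=> tdens mU Woo tW mf f0 fW; have [mt t0 t1] := tdens.
have [_ mtr] := measurable_kernel_section tdens.
pose fU := f \_ U.
have mfU : measurable_fun setT fU.
  by apply/(measurable_restrictT f mU); exact: measurable_funS mf.
have fU0 s : 0 <= fU s by rewrite /fU patchE; case: ifP.
have tfU x : (\int[nu]_(s in U) (t x s * f s)%:E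
    = \int[nu]_s (t x s * fU s)%:E)%E.
  rewrite integral_mkcond; apply: eq_integral => s _.
  by rewrite /fU !patchE; case: ifP => // _; rewrite mulr0.
have [] := @fubini_tonelli_sigma_finite_support _ _ _ nu W
  (fun p => (t p.1 p.2 * fU p.2)%:E) Woo.
- apply/measurable_EFinP; apply: measurable_funM => //.
  exact: measurableT_comp.
- by move=> p; rewrite lee_fin mulr_ge0.
- by move=> x y /tW ->; rewrite mul0r.
- by move=> x y /fW fy0; rewrite /fU patchE /= fy0 if_same mulr0.
move=> mI IE; split.
  by under eq_fun do rewrite tfU.
under eq_integral do rewrite tfU.
rewrite IE [RHS]integral_mkcond; apply: eq_integral => s _ /=.
under eq_integral do rewrite mulrC EFinM.
rewrite ge0_integralZl_EFin//.
- by rewrite t1 mule1 /fU !patchE; case: ifP.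
- by move=> x _; rewrite lee_fin.
- exact/measurable_EFinP.
Qed.

(** The invariant of the iterates [mu_]. The mass is only bounded by one, since what leaves [U] is
    lost; the support in [W] allows Tonelli's theorem again at the next step. *)
Record subdensity d (S : measurableType d) (R : realType)
    (nu : {measure set S -> \bar R}) (U W : set S) (f : S -> R) : Prop := {
  subdensity_measurable : measurable_fun setT f ;
  subdensity_ge0 : forall s, 0 <= f s ;
  subdensity_support : forall s, ~ W s -> f s = 0 ;
  subdensity_mass : (\int[nu]_(s in U) (f s)%:E <= 1)%E
}.

Lemma subdensity_integrable d (S : measurableType d) (R : realType)
    (nu : {measure set S -> \bar R}) (U W : set S) (f : S -> R) :
  measurable U -> subdensity nu U W f -> nu.-integrable U (EFin \o f).
Proof.
move=> mU [mf f0 _ f1]; apply/integrableP; split.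
  by apply/measurable_EFinP; exact: measurable_funS mf.
under eq_integral do rewrite /= ger0_norm//.
exact: le_lt_trans f1 (ltry _).
Qed.

(* If the integral were infinite at one point, then by the Lipschitz condition
   it would be infinite everywhere, contradicting mass preservation. *)
Lemma kernel_integral_lty d (R : realType) (S : borelMetricType d R)
    (nu : {measure set S -> \bar R}) (t : S -> S -> R) (lambda : R)
    (U W : set S) (f : S -> R) (x : S) :
  transition_density nu t ->
  (forall s x y, `|t x s - t y s| <= lambda * mdist x y) ->
  (0 < nu setT)%E -> measurable U -> sigma_finite W nu ->
  (forall x s, ~ W x -> t x s = 0) -> subdensity nu U W f ->
  (\int[nu]_(s in U) (t x s * f s)%:E < +oo)%E.
Proof.
move=> tdens lip nu0 mU Woo tW fd; have [mf f0 fW f1] := fd.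
have [mtl _] := measurable_kernel_section tdens.
have [_ IE] := kernel_mass_preserving tdens mU Woo tW mf f0 fW.
have t0 := tdensity_ge0 tdens.
have mfU : measurable_fun U f by exact: measurable_funS mf.
have mtfU y : measurable_fun U (fun s => t y s * f s).
  by apply: measurable_funM => //; exact: measurable_funS (mtl y).
rewrite ltey; apply/eqP => xoo.
have oo y : (\int[nu]_(s in U) (t y s * f s)%:E = +oo)%E.
  apply/eqP; rewrite -leye_eq -xoo.
  have c0 : 0 <= lambda * mdist x y by exact: le_trans (lip x x y).
  have : (\int[nu]_(s in U) (t x s * f s)%:E <= \int[nu]_(s in U)
     ((t y s * f s)%:E + (lambda * mdist x y * f s)%:E))%E.
    apply: ge0_le_integral => //.
    - by move=> s _; rewrite lee_fin mulr_ge0.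
    - exact/measurable_EFinP.
    - apply: emeasurable_funD; apply/measurable_EFinP => //.
      exact: measurable_funM.
    - move=> s _; rewrite -EFinD lee_fin -mulrDl ler_wpM2r//.
      by have := lip s x y; rewrite ler_norml => /andP[_ ?]; lra.
  rewrite ge0_integralD//; first last.
  - by apply/measurable_EFinP; exact: measurable_funM.
  - by move=> s _; rewrite lee_fin mulr_ge0.
  - exact/measurable_EFinP.
  - by move=> s _; rewrite lee_fin mulr_ge0.
  under [X in (_ <= _ + X)%E -> _]eq_integral do rewrite EFinM.
  rewrite ge0_integralZl_EFin//; first last.
  - exact/measurable_EFinP.
  - by move=> s _; rewrite lee_fin.
  rewrite xoo !leye_eq; apply: contraLR; rewrite -!ltey => Ioo.
  apply: lte_add_pinfty => //; apply: le_lt_trans (ltry (lambda * mdist x y)).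
  by rewrite -[leRHS]mule1 lee_wpmul2l.
(* As [nu] is not zero, the constant +oo has infinite integral, while the mass of [f] on [U] is at
   most one. *)
move: IE; under eq_integral do rewrite oo.
rewrite -/(cst _) integral_cst// gt0_mulye// => h.
by move: f1; rewrite -h leye_eq.
Qed.

(** Finiteness is required because [Rop] is real-valued and would turn an infinite integral into 0.
    The mass is preserved over the whole space, hence can only drop on [U]. *)
Lemma subdensity_Rop d (S : measurableType d) (R : realType)
    (nu : {measure set S -> \bar R}) (t : S -> S -> R) (U W : set S)
    (f : S -> R) :
  transition_density nu t -> measurable U -> sigma_finite W nu ->
  (forall x s, ~ W x -> t x s = 0) ->
  (forall x, \int[nu]_(s in U) (t x s * f s)%:E < +oo)%E ->
  subdensity nu U W f -> subdensity nu U W (Rop nu t U f).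
Proof.
move=> tdens mU Woo tW tfoo [mf f0 fW f1].
have t0 := tdensity_ge0 tdens.
have [mI IE] := kernel_mass_preserving tdens mU Woo tW mf f0 fW.
have RE : EFin \o Rop nu t U f = (fun x => \int[nu]_(s in U) (t x s * f s)%:E)%E.
  apply/funext => x /=; rewrite fineK// ge0_fin_numE//.
  by apply: integral_ge0 => s _; rewrite lee_fin mulr_ge0.
have mR : measurable_fun setT (EFin \o Rop nu t U f) by rewrite RE.
have R0 x : 0 <= Rop nu t U f x.
  by apply: Rintegral_ge0 => s _; rewrite mulr_ge0.
split => //.
- exact/measurable_EFinP.
- move=> x xW; rewrite /Rop /Rintegral integral0_eq// => s _.
  by rewrite tW// mul0r.
- apply: le_trans f1; rewrite -IE -RE.
  by apply: ge0_subset_integral => // x _; rewrite lee_fin.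
Qed.

(** The difference of the two kernels is integrated against a mass of at most one, so the
    oscillation enters with factor 1 rather than [M]. *)
Lemma Rop_modulus d (S : measurableType d) (R : realType)
    (nu : {measure set S -> \bar R}) (t : S -> S -> R) (U W : set S)
    (f : S -> R) (x y : S) (c : R) :
  measurable U -> subdensity nu U W f -> 0 <= c ->
  (forall s, `|t x s - t y s| <= c) ->
  nu.-integrable U (fun s => (t x s * f s)%:E) ->
  nu.-integrable U (fun s => (t y s * f s)%:E) ->
  `|Rop nu t U f x - Rop nu t U f y| <= c.
Proof.
move=> mU fd c0 tc ix iy; have [mf f0 _ f1] := fd.
have fi := subdensity_integrable mU fd.
rewrite /Rop -RintegralB//.
have iB : nu.-integrable U (EFin \o (fun s => t x s * f s - t y s * f s)).
  rewrite (_ : _ \o _ = (fun s => (t x s * f s)%:E) \- (fun s => (t y s * f s)%:E))%E.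
    exact: integrableB.
  by apply/funext.
apply: le_trans (le_normr_Rintegral mU iB) _.
apply: (@le_trans _ _ (\int[nu]_(s in U) (c * f s))).
  apply: le_Rintegral => //.
  - exact: integrable_norm iB.
  - exact: integrableZl fi.
  - by move=> s _; rewrite -mulrBl normrM (ger0_norm (f0 s)) ler_wpM2r.
rewrite RintegralZl// ler_piMr//.
rewrite -lee_fin fineK//; exact: integrable_fin_num.
Qed.

(** * Step functions and the matrix recursion *)

Lemma Rintegral_sum d (S : measurableType d) (R : realType)
    (nu : {measure set S -> \bar R}) (U : set S) (I : Type) (r : seq I)
    (F : I -> S -> R) :
  measurable U -> (forall i, nu.-integrable U (EFin \o F i)) ->
  \int[nu]_(s in U) (\sum_(i <- r) F i s) = \sum_(i <- r) \int[nu]_(s in U) F i s.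
Proof.
move=> mU iF; rewrite /Rintegral.
under eq_integral do rewrite -sumEFin.
rewrite integral_sum// -sum_fine// => i _.
exact: integrable_fin_num (iF i).
Qed.

Lemma sum_indic_partition (S : Type) (R : realType) (n : nat)
    (A : 'I_n -> set S) (a : 'I_n -> R) (i : 'I_n) (x : S) :
  trivIset setT A -> A i x -> \sum_(j < n) a j * \1_(A j) x = a i.
Proof.
move=> tA Aix; rewrite (bigD1 i)//= indicE mem_set// mulr1 big1 ?addr0// => j ji.
rewrite indicE memNset ?mulr0// => Ajx; move/eqP: ji; apply.
by apply: (tA j i) => //; exists x.
Qed.

(** [psi] is constant on each cell, so integrating cell by cell yields the entries of [Pmx]. Index 0
    is excluded because [alpha] there repeats its value at 1. *)
Lemma Rop_psi d (S : measurableType d) (R : realType)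
    (nu : {measure set S -> \bar R}) (t : S -> S -> R) (U : set S) (n : nat)
    (A : 'I_n -> set S) (r : 'I_n -> S) (mu0 : S -> R) (k : nat) (i : 'I_n) :
  is_partition U A -> measurable U ->
  (forall x, nu.-integrable U (EFin \o t x)) -> (0 < k)%N ->
  alpha nu t U A r mu0 k.+1 ord0 i = Rop nu t U (psi nu t U A r mu0 k) (r i).
Proof.
move=> [mA _ UA] mU ti; case: k => // k _.
rewrite /alpha /= -/(alpha nu t U A r mu0 k.+1) mxE /Rop /psi.
under eq_Rintegral do rewrite mulr_sumr.
have AU j : A j `<=` U by rewrite UA => x; exists j.
have tAE j s : t (r i) s * (alpha nu t U A r mu0 k.+1 ord0 j * \1_(A j) s) =
    alpha nu t U A r mu0 k.+1 ord0 j * (t (r i) \_ (A j)) s.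
  by rewrite mulrCA patchE indicE; case: ifP => _; rewrite ?mulr1// !mulr0.
have tAi j : nu.-integrable U (EFin \o (t (r i) \_ (A j))).
  rewrite (_ : EFin \o _ = (EFin \o t (r i)) \_ (A j)); last first.
    by apply/funext => s /=; rewrite !patchE; case: ifP.
  apply/integrable_restrict => //.
  by rewrite setIidr//; exact: integrableS (ti (r i)).
rewrite Rintegral_sum//; last first.
  move=> j; rewrite (_ : EFin \o _ = fun s => ((alpha nu t U A r mu0 k.+1 ord0 j)%:E *
      (EFin \o (t (r i) \_ (A j))) s)%E).
    exact: integrableZl.
  by apply/funext => s /=; rewrite -EFinM tAE.
apply: eq_bigr => j _.
under eq_Rintegral do rewrite tAE.
rewrite RintegralZl// mxE -Rintegral_mkcondr setIidr//.
Qed.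

(** * The constants of the bound *)

(** The shape of the error recursion: a fresh unit of error plus [M] times the previous one. *)
Lemma kappaS (R : realType) (k : nat) (M : R) :
  kappa k.+1 M = 1 + M * kappa k M.
Proof.
rewrite /kappa; case: eqVneq => [->|M1]; first by rewrite mul1r -natr1 addrC.
have M0 : 1 - M != 0 by rewrite subr_eq0 eq_sym.
by rewrite exprS; field.
Qed.

(** Boundedness of [U] makes each [diam] a genuine supremum. *)
Lemma mdist_le_mesh (R : realType) (S : metricType R) (U : set S) (n : nat)
    (A : 'I_n -> set S) (i : 'I_n) (x y : S) :
  mbounded U -> A i `<=` U -> A i x -> A i y -> mdist x y <= mesh A.
Proof.
move=> [b Ub] AU Ax Ay; apply: le_trans (le_bigmax _ _ i).
apply: ub_le_sup; last by exists x => //; exists y.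
by exists b => _ [u Au [v Av <-]]; apply: Ub; exact: AU.
Qed.

(* A negative [lambda] is possible only if all distances vanish. *)
Lemma lipschitz_mdist_le_mesh (R : realType) (S : metricType R) (U : set S)
    (n : nat) (A : 'I_n -> set S) (lambda : R) (i : 'I_n) (x y : S) :
  (forall u v : S, 0 <= lambda * mdist u v) ->
  mbounded U -> A i `<=` U -> (forall j, A j !=set0) -> A i x -> A i y ->
  lambda * mdist x y <= lambda * mesh A.
Proof.
move=> l0 bU AU A0 Ax Ay; have [lge|llt] := leP 0 lambda.
  by rewrite ler_wpM2l//; exact: (mdist_le_mesh bU AU).
have d0 (u v : S) : mdist u v = 0.
  apply/eqP; rewrite eq_le mdist_ge0 andbT.
  by have := l0 u v; rewrite nmulr_rge0.
have mesh_le0 : mesh A <= 0.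
  apply/bigmax_leP; split => // j _; have [z Az] := A0 j.
  apply: ge_sup; first by exists (mdist z z); exists z => //; exists z.
  by move=> _ [u _ [v _ <-]]; rewrite d0.
by rewrite d0 mulr0 nmulr_rge0.
Qed.

(** * The two error bounds *)

Theorem theorem6p1 (R : realType) (d : measure_display)
    (S : borelMetricType d R) (nu : {measure set S -> \bar R})
    (t : S -> S -> R) (lambda M : R)
    (U : set S) (n : nat) (A : 'I_n -> set S) (r : 'I_n -> S) :
  separable S ->
  transition_density nu t ->
  (forall s sbar sbar' : S,
     `|t sbar s - t sbar' s| <= lambda * mdist sbar sbar') ->
  Mf nu t = M%:E ->
  mbounded U ->
  is_partition U A ->
  (forall i, A i (r i)) ->
  (forall s, U s ->
     (supnorm U (fun x => step_proj A r (fun sbar => t sbar s) x - t x s)%R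
        <= (lambda * mesh A)%:E)%E)
  /\
  (forall (pi0 : S -> R) (Lambda0 : set S) (mu0 : S -> R) (N : nat),
     probability_density nu pi0 ->
     measurable Lambda0 ->
     Lambda0 `<=` U ->
     mu0 = (fun s => \1_Lambda0 s * pi0 s) ->
     forall k : nat, (1 <= k <= N)%N ->
       (supnorm U (fun x => mu_ nu t U mu0 k x - psi nu t U A r mu0 k x)%R
          <= (lambda * mesh A * kappa k M)%:E)%E).
Proof.
move=> sepS tdens lip MfE bU partA Ar; have [mA tA UA] := partA.
have l0 (u v : S) : 0 <= lambda * mdist u v by exact: le_trans (lip u u v).
have AU i : A i `<=` U by rewrite UA => x; exists i.
have tr i x s : A i x -> `|t x s - t (r i) s| <= lambda * mesh A.
  move=> Aix; apply: le_trans (lip _ _ _) _.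
  by apply: (lipschitz_mdist_le_mesh l0 bU (AU i)) => // j; exists (r j).
split=> [s _|pi0 Lambda0 mu0 N [mpi pi_ge0 pi_int] mL LU mu0E k /andP[k0 _]].
  apply: ge_ereal_sup => _ [x + <-]; rewrite {1}UA => -[i _ Aix].
  by rewrite lee_fin /step_proj (sum_indic_partition _ tA Aix) distrC tr.
have mU : measurable U by rewrite UA; apply: fin_bigcup_measurable.
have nu0 : (0 < nu setT)%E.
  rewrite lt0e measure_ge0 andbT; apply/eqP => nuT0.
  have /eqP := null_set_integral measurableT
    ((measurable_EFinP setT pi0).2 mpi) nuT0.
  by rewrite pi_int onee_eq0.
have [x0 _] : [set: S] !=set0.
  apply/set0P; apply/eqP => T0; by rewrite T0 measure0 ltxx in nu0.
have [sq sqP] := countable_kernel_supports x0 sepS lip.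
have [mtl mtr] := measurable_kernel_section tdens.
have [_ t0 t1] := tdens.
(* All these functions have integral 1; their joint support [W] contains that of [pi0] and of every
   section of [t]. *)
pose h i := if i is j.+1 then t ^~ (sq j) else pi0.
have Woo : sigma_finite [set x | exists i, 0 < h i x] nu.
  apply: sigma_finite_support => -[|j] //=.
  - by rewrite pi_int ltry.
  - by rewrite t1 ltry.
set W := [set x | _] in Woo.
have tW x s : ~ W x -> t x s = 0.
  move=> Wx; apply/eqP/negPn/negP => ts0; apply: Wx.
  have [|i ti] := sqP x s; first by rewrite lt_neqAle eq_sym ts0 t0.
  by exists i.+1.
have mu0d : subdensity nu U W mu0.
  rewrite mu0E; split.
  - by apply: measurable_funM => //; exact: measurable_indic.
  - by move=> s; rewrite mulr_ge0.
  - move=> s Ws; suff -> : pi0 s = 0 by rewrite mulr0.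
    apply/eqP/negPn/negP => ps0; apply: Ws; exists 0%N.
    by rewrite /= lt_neqAle eq_sym ps0 pi_ge0.
  - rewrite -pi_int integral_mkcond; apply: ge0_le_integral => //.
    + by move=> s _; rewrite patchE; case: ifP => // _; rewrite lee_fin mulr_ge0.
    + apply/(measurable_restrictT _ mU)/measurable_funTS/measurable_EFinP.
      by apply: measurable_funM => //; exact: measurable_indic.
    + exact/measurable_EFinP.
    + move=> s _; rewrite patchE; case: ifP => _; rewrite lee_fin//.
      by rewrite ler_piMl// indicE; case: (_ \in _).
have mud j : subdensity nu U W (mu_ nu t U mu0 j).
  elim: j => // j IH; rewrite /mu_ iterS; apply: subdensity_Rop => // x.
  exact: (kernel_integral_lty _ tdens lip nu0 mU Woo tW).
have tmui j x : nu.-integrable U (fun s => (t x s * mu_ nu t U mu0 j s)%:E).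
  have [mm m0 _ _] := mud j.
  apply/integrableP; split.
    by apply/measurable_EFinP/measurable_funTS/measurable_funM.
  under eq_integral do rewrite /= ger0_norm ?mulr_ge0//.
  exact: (kernel_integral_lty _ tdens lip nu0 mU Woo tW).
have tM x : (\int[nu]_s (t x s)%:E <= M%:E)%E.
  by rewrite -MfE; apply: ereal_sup_ubound; exists x.
have tiT x : nu.-integrable setT (EFin \o t x).
  apply/integrableP; split; first exact/measurable_EFinP.
  under eq_integral do rewrite /= ger0_norm//.
  exact: le_lt_trans (tM x) (ltry _).
have ti x : nu.-integrable U (EFin \o t x) by exact: integrableS (tiT x).
have M0 : 0 <= M.
  by rewrite -lee_fin; apply: le_trans (tM x0); apply: integral_ge0 => s _;
    rewrite lee_fin.
have tMU x : \int[nu]_(s in U) t x s <= M.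
  rewrite -lee_fin fineK; last exact: integrable_fin_num (ti x).
  apply: le_trans (tM x); apply: ge0_subset_integral => //.
    exact/measurable_EFinP.
  by move=> s _; rewrite lee_fin.
suff bnd : forall j i x, A i x ->
    `|mu_ nu t U mu0 j.+1 x - psi nu t U A r mu0 j.+1 x|
    <= lambda * mesh A * kappa j.+1 M.
  apply: ge_ereal_sup => _ [x + <-]; rewrite {1}UA => -[i _ Aix].
  by rewrite lee_fin; case: k k0 => // k _; exact: bnd Aix.
elim=> [|j IH] i x Aix; rewrite kappaS /psi (sum_indic_partition _ tA Aix);
  have lm0 : 0 <= lambda * mesh A by exact: le_trans (tr i x x0 Aix).
(* [kappa 0 M] is 0 in both branches. As [alpha1] is [Rop mu0] at the representatives, the first
   error is pure oscillation. *)
- rewrite /kappa expr0 subrr mul0r if_same mulr0 addr0 mulr1 /alpha /alpha1 mxE.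
  apply: (Rop_modulus mU mu0d lm0) => [s||]; first exact: tr.
  - exact: (tmui 0%N).
  - exact: (tmui 0%N).
have m_ := subdensity_measurable (mud j.+1).
pose e s := mu_ nu t U mu0 j.+1 s - psi nu t U A r mu0 j.+1 s.
set c := lambda * mesh A * kappa j.+1 M.
have ec s : U s -> `|e s| <= c by rewrite {1}UA => -[l _ Als]; exact: IH Als.
have me : measurable_fun setT e.
  apply: measurable_funB => //; apply: measurable_sum => l.
  by apply: measurable_funM => //; exact: measurable_indic.
(* The induction hypothesis bounds [e] by [c] on [U], so [c] times the kernel dominates. *)
have tei : nu.-integrable U (EFin \o (fun s => t (r i) s * e s)).
  apply: (@le_integrable _ _ _ _ _ _ _ (fun s => c%:E * (EFin \o t (r i)) s)%E) => //.
  - by apply/measurable_EFinP/measurable_funTS/measurable_funM.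
  - move=> s Us /=; rewrite lee_fin (normrM c) normrM mulrC ler_wpM2r//.
    exact: le_trans (ec s Us) (ler_norm _).
  - exact: integrableZl.
rewrite Rop_psi//.
(* Inserting [mu_] at [r i] separates the oscillation over the cell from the propagated error. *)
rewrite mulrDr mulr1 -(subrKA (mu_ nu t U mu0 j.+2 (r i))).
apply: le_trans (ler_normD _ _) _; apply: lerD.
  apply: (Rop_modulus mU (mud j.+1) lm0) => [s||]; first exact: tr.
  - exact: tmui.
  - exact: tmui.
have tpi : nu.-integrable U (fun s => (t (r i) s * psi nu t U A r mu0 j.+1 s)%:E).
  rewrite (_ : (fun s => _) = ((fun s => (t (r i) s * mu_ nu t U mu0 j.+1 s)%R%:E) \-
    (EFin \o (fun s => t (r i) s * e s)%R))%E); first exact: integrableB.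
  by apply/funext => s /=; rewrite -EFinB -mulrBr; congr (_ * _)%:E; rewrite subKr.
rewrite {1}/mu_ iterS -/(mu_ nu t U mu0 j.+1) /Rop -RintegralB//;
  last exact: tmui.
rewrite (_ : (fun s => _) = (fun s => t (r i) s * e s)); last first.
  by apply/funext => s; rewrite -mulrBr.
apply: le_trans (le_normr_Rintegral mU tei) _.
apply: (@le_trans _ _ (\int[nu]_(s in U) (c * t (r i) s))).
  apply: le_Rintegral => //.
  - exact: integrable_norm tei.
  - exact: integrableZl (ti _).
  - by move=> s Us; rewrite normrM (ger0_norm (t0 _ _)) mulrC ler_wpM2r// ec.
rewrite RintegralZl//.
(* The point x of the cell gives [c] at least [|e x|]; this sign is needed to replace the kernel
   integral by [M]. *)
have c0 : 0 <= c by exact: le_trans (ec x (AU i x Aix)).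
by rewrite [leRHS](_ : _ = c * M) ?ler_wpM2l// /c; ring.
Qed.
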